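(* Let $\underline{A},\overline{A}\in\mathbb{R}^{n\times n}$ with $\underline{A}\le\overline{A}$ (entrywise), let $\mathbf{A}=\{A\in\mathbb{R}^{n\times n} : \underline{A}\le A\le\overline{A}\}$, and let $A^c=\frac12(\underline{A}+\overline{A})$, $A^\Delta=\frac12(\overline{A}-\underline{A})$. Then $\mathbf{A}$ is strongly principally nondegenerate if and only if $$\det\left(D_{e-|y|}+D_{|y|}A^cD_{|z|}\right)\,\det\left(D_{e-|y|}+D_{|y|}A^cD_{|z|}-D_yA^\Delta D_z\right)>0$$ for each $y,z\in\{0,\pm1\}^n$ such that $|y|=|z|$.
   Context: A matrix property holds strongly for an interval matrix $\mathbf{A}$ if it holds for every $A\in\mathbf{A}$. A matrix $A\in\mathbb{R}^{n\times n}$ is principally nondegenerate if all its principal minors are nonzero. For a vector $s\in\mathbb{R}^n$, $D_s$ is the diagonal matrix with diagonal entries $s_1,\dots,s_n$; $e=(1,\dots,1)^T$; $|y|$ is the entrywise absolute value. *)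

(* Defs.v *)
From HB Require Import structures.
From mathcomp Require Import all_boot all_order all_algebra.
From mathcomp Require Import reals.

Set Implicit Arguments.
Unset Strict Implicit.
Unset Printing Implicit Defensive.

Import Order.TTheory GRing.Theory Num.Theory.
Local Open Scope ring_scope.

Definition lemx (R : realType) (m n : nat) (A B : 'M[R]_(m, n)) : Prop :=
  forall i j, A i j <= B i j.

Definition interval_mx (R : realType) (n : nat) (Al Au A : 'M[R]_n) : Prop :=
  lemx Al A /\ lemx A Au.

Definition midpoint_mx (R : realType) (n : nat) (Al Au : 'M[R]_n) : 'M[R]_n :=
  2^-1 *: (Al + Au).

Definition radius_mx (R : realType) (n : nat) (Al Au : 'M[R]_n) : 'M[R]_n :=
  2^-1 *: (Au - Al).

Definition holds_strongly (R : realType) (n : nat)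
    (P : 'M[R]_n -> Prop) (bA : 'M[R]_n -> Prop) : Prop :=
  forall A, bA A -> P A.

(* The submatrix keeps the rows and columns of A indexed by I, in increasing
   order, since enum_val enumerates I increasingly. *)
Definition principal_minor (R : realType) (n : nat) (A : 'M[R]_n)
    (I : {set 'I_n}) : R :=
  \det (mxsub (fun i : 'I_#|I| => enum_val i)
              (fun j : 'I_#|I| => enum_val j) A).

Definition principally_nondegenerate (R : realType) (n : nat)
    (A : 'M[R]_n) : Prop :=
  forall I : {set 'I_n}, I != set0 -> principal_minor A I != 0.

(* Vectors are rows, the shape diag_mx expects. *)
Definition sign0_vec (R : realType) (n : nat) (y : 'rV[R]_n) : Prop :=
  forall i, y 0 i \in [:: 0; 1; -1].

(* Entrywise absolute value, not a matrix norm. *)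
Definition absv (R : realType) (n : nat) (y : 'rV[R]_n) : 'rV[R]_n :=
  map_mx Num.norm y.

(* Main.v *)
Require Import Defs.
From HB Require Import structures.
From mathcomp Require Import all_boot all_order all_algebra.
From mathcomp Require Import reals.
From mathcomp Require Import ring lra.

Set Implicit Arguments.
Unset Strict Implicit.
Unset Printing Implicit Defensive.

Import Order.TTheory GRing.Theory Num.Theory.
Local Open Scope ring_scope.

(** For [y, z] with common support [I], the second determinant is the minor on
    [I] of the member [Ac - D_y Ad D_z] of the interval. It moves continuously
    from the minor of [Ac] without vanishing when the interval is
    nondegenerate, so the two have the same sign.
    Conversely, let the minor on [I] of some [A] in the interval vanish, and
    take [x <> 0] supported on [I] with [A x = 0] on [I]. There
    [|Ac x| <= Ad |x|], so with [z] the sign vector of [x] one can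
    write [Ac x = D_t Ad D_z x] with [|t_i| <= 1]. The determinant of the
    padded [Ac - D_t Ad D_z] is affine in each [t_i], so being nonzero of
    one sign at the vertices of the cube it cannot vanish at [t]. *)

(** * Kernel vectors and padded principal minors *)

Lemma det0_col (F : fieldType) (n : nat) (A : 'M[F]_n) :
  \det A = 0 <-> exists2 x : 'cV[F]_n, x != 0 & A *m x = 0.
Proof.
rewrite -det_tr; split=> [/eqP/det0P[v v0 vA]|[x x0 Ax]].
  exists v^T.
    by apply: contra_neq v0 => vT; rewrite -[v]trmxK vT trmx0.
  by apply: trmx_inj; rewrite trmx_mul trmxK trmx0.
apply/eqP/det0P; exists x^T.
  by apply: contra_neq x0 => xT; rewrite -[x]trmxK xT trmx0.
by rewrite -trmx_mul Ax trmx0.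
Qed.

(* Padding by the identity off the support of a 0/1 vector [u] lets principal
   minors be studied without changing the dimension. *)
Definition pad_mx (F : fieldType) (n : nat) (u : 'rV[F]_n) (A : 'M[F]_n) :
    'M[F]_n :=
  diag_mx (const_mx 1 - u) + diag_mx u *m A *m diag_mx u.

Lemma pad_mxE (F : fieldType) (n : nat) (u : 'rV[F]_n) (A : 'M[F]_n) i j :
  pad_mx u A i j = (1 - u 0 i) *+ (i == j) + u 0 i * A i j * u 0 j.
Proof. by rewrite /pad_mx mul_diag_mx mul_mx_diag !mxE. Qed.

Definition indic_vec (F : fieldType) (n : nat) (I : {set 'I_n}) : 'rV[F]_n :=
  \row_i (i \in I)%:R.

Lemma pad_mx_mulE (F : fieldType) (n : nat) (I : {set 'I_n}) (A : 'M[F]_n)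
    (x : 'cV[F]_n) i :
  (pad_mx (indic_vec F I) A *m x) i 0 =
  if i \in I then \sum_(j in I) A i j * x j 0 else x i 0.
Proof.
rewrite mxE; under eq_bigr => j _ do rewrite pad_mxE !mxE.
case: ifP => iI.
  rewrite [RHS]big_mkcond; apply: eq_bigr => j _.
  by rewrite subrr mul0rn add0r mul1r; case: ifP => _; rewrite ?mulr1 ?mulr0 ?mul0r.
rewrite (bigD1 i) //= eqxx subr0 mulr1n !mul0r addr0 mul1r big1 ?addr0 // => j ji.
by rewrite eq_sym (negPf ji) !mul0r addr0 mul0r.
Qed.

(** Kernel vectors correspond: one of the submatrix extends by zero, and one of the padded matrix
    vanishes off [I], where the padded rows are identity rows, so it restricts. *)
Lemma principal_minor_pad (R : realType) (n : nat) (A : 'M[R]_n)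
    (I : {set 'I_n}) :
  principal_minor A I = 0 <-> \det (pad_mx (indic_vec R I) A) = 0.
Proof.
rewrite /principal_minor; split=> /det0_col[x x0 Ax]; apply/det0_col.
  pose v : 'cV[R]_n := \col_i oapp (x^~ 0) 0 [pick k | enum_val k == i :> 'I_n].
  have vE k : v (enum_val k) 0 = x k 0.
    rewrite mxE; case: pickP => [l /eqP/enum_val_inj -> //|/(_ k)].
    by rewrite eqxx.
  exists v.
    apply: contra_neq x0 => v0; apply/matrixP => k l.
    by rewrite ord1 -vE v0 !mxE.
  apply/matrixP => i j; rewrite ord1 pad_mx_mulE mxE; case: ifP => iI.
    rewrite big_enum_val /=.
    have := congr1 (fun M : 'cV__ => M (enum_rank_in iI i) 0) Ax.
    rewrite !mxE => AxI; rewrite -[RHS]AxI; apply: eq_bigr => k _.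
    by rewrite vE mxE enum_rankK_in.
  rewrite mxE; case: pickP => // k /eqP ki.
  by move: (enum_valP k); rewrite ki iI.
have xE i : i \notin I -> x i 0 = 0.
  move=> iI; have := pad_mx_mulE I A x i.
  by rewrite (negPf iI) => <-; rewrite Ax mxE.
exists (\col_k x (enum_val k) 0).
  apply: contra_neq x0 => v0; apply/matrixP => i j; rewrite ord1 mxE.
  have [iI|/xE //] := boolP (i \in I).
  have := congr1 (fun M : 'cV__ => M (enum_rank_in iI i) 0) v0.
  by rewrite !mxE enum_rankK_in.
apply/matrixP => k l; rewrite ord1 mxE [RHS]mxE.
have := pad_mx_mulE I A x (enum_val k).
rewrite Ax mxE enum_valP big_enum_val /= => AxI; rewrite [RHS]AxI.
by apply: eq_bigr => m _; rewrite !mxE.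
Qed.

(** * Sign of determinants over cubes and segments *)

Definition upd_vec (T : Type) (n : nat) (t : 'rV[T]_n) (i : 'I_n) (a : T) :
    'rV[T]_n := \row_j if j == i then a else t 0 j.

(** For [t 0 i] in [-1, 1] the two weights are nonnegative with sum 1, so coordinates can be pushed
    to 1 or -1 one at a time. The list [s] says which ones move; the others keep their value. *)
Lemma multiaffine_gt0 (R : realFieldType) (n : nat) (F : 'rV[R]_n -> R) :
  (forall (t : 'rV[R]_n) i, F t = (1 + t 0 i) / 2 * F (upd_vec t i 1)
                     + (1 - t 0 i) / 2 * F (upd_vec t i (- 1))) ->
  forall (s : seq 'I_n) (t : 'rV[R]_n),
  {in s, forall i, `|t 0 i| <= 1} ->
  (forall t' : 'rV[R]_n, {in s, forall i, t' 0 i = 1 \/ t' 0 i = - 1} ->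
     (forall i, i \notin s -> t' 0 i = t 0 i) -> 0 < F t') ->
  0 < F t.
Proof.
move=> Faff; elim=> [|i s IHs] t ht hF; first exact: hF.
have step a : a = 1 \/ a = - 1 -> 0 < F (upd_vec t i a).
  move=> ha; have uE j : upd_vec t i a 0 j = if j == i then a else t 0 j.
    by rewrite mxE.
  apply: IHs => [j js|t' t's t'E].
    rewrite uE; case: eqP => _; last by apply: ht; rewrite inE js orbT.
    by case: ha => ->; rewrite ?normrN normr1.
  apply: hF => j.
    rewrite inE; have [/t's //|js] := boolP (j \in s).
    by rewrite orbF => ji; rewrite t'E // uE ji.
  by rewrite inE negb_or => /andP[ji js]; rewrite t'E // uE (negPf ji).
have := ht i (mem_head _ _); rewrite ler_norml (Faff t i) => /andP[t1 t2].
have p1 := step 1 (or_introl erefl); have p2 := step (-1) (or_intror erefl).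
by nra.
Qed.

(** The entry [t 0 i] enters row [i] only, and the determinant is linear in that row. *)
Lemma det_row_affine (R : realFieldType) (n : nat) (P Q : 'M[R]_n)
    (t : 'rV[R]_n) i :
  let F t := \det (P - diag_mx t *m Q) in
  F t = (1 + t 0 i) / 2 * F (upd_vec t i 1)
        + (1 - t 0 i) / 2 * F (upd_vec t i (- 1)).
Proof.
apply: (@determinant_multilinear _ _ _ _ _ i).
- by apply/rowP => j; rewrite !mul_diag_mx !mxE eqxx; field.
- apply/matrixP => j k; rewrite !mul_diag_mx !mxE.
  by rewrite eq_sym (negPf (neq_lift _ _)).
- apply/matrixP => j k; rewrite !mul_diag_mx !mxE.
  by rewrite eq_sym (negPf (neq_lift _ _)).
Qed.

Lemma det_segment_gt0 (R : rcfType) (n : nat) (P Q : 'M[R]_n) :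
  (forall t, 0 <= t <= 1 -> \det (P - t *: Q) != 0) ->
  0 < \det P * \det (P - Q).
Proof.
move=> dn0; pose p := \det (map_mx polyC P - 'X *: map_mx polyC Q).
have pE t : p.[t] = \det (P - t *: Q).
  rewrite /p -horner_evalE -det_map_mx; congr (\det _).
  by apply/matrixP => i j; rewrite !mxE /= /horner_eval !hornerE.
have p0 : p.[0] = \det P by rewrite pE scale0r subr0.
have p1 : p.[1] = \det (P - Q) by rewrite pE scale1r.
rewrite -p0 -p1 ltNge; apply/negP => ple0.
have [t /andP[t0 t1] /rootP] : exists2 t, 0 <= t <= 1 & root p t.
  have [p0le|p0gt] := leP p.[0] 0.
    apply: poly_ivt => //; rewrite p0le /= leNgt; apply/negP => p1lt.
    have : p.[0] != 0 by rewrite pE dn0 // lexx ler01.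
    by nra.
  (* [poly_ivt] asks for a value at most 0 on the left and at least 0 on the right, hence the change
     of sign. *)
  have [|t tI] := @poly_ivt _ (- p) 0 1 ler01.
    by rewrite !hornerN oppr_le0 oppr_ge0 (ltW p0gt) /=; nra.
  by rewrite rootN; exists t.
by apply/eqP; rewrite pE dn0 // t0 t1.
Qed.

(** * Interval matrices and sign vectors *)

Lemma interval_mx_bound (R : realType) (n : nat) (Al Au A : 'M[R]_n) :
  interval_mx Al Au A <->
  forall i j, `|midpoint_mx Al Au i j - A i j| <= radius_mx Al Au i j.
Proof.
split=> [[lA uA] i j|h].
  by move: (lA i j) (uA i j); rewrite !mxE ler_norml => ? ?; lra.
by split=> i j; move: (h i j); rewrite !mxE ler_norml => ?; lra.
Qed.

Lemma radius_mx_ge0 (R : realType) (n : nat) (Al Au : 'M[R]_n) i j :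
  lemx Al Au -> 0 <= radius_mx Al Au i j.
Proof. by move=> /(_ i j) h; rewrite !mxE; lra. Qed.

Lemma sign0_absvE (R : realType) (n : nat) (y : 'rV[R]_n) :
  sign0_vec y -> absv y = indic_vec R [set i | y 0 i != 0].
Proof.
move=> hy; apply/rowP => i; rewrite !mxE inE; have := hy i.
by rewrite !inE => /or3P[] /eqP ->;
  rewrite ?eqxx ?normr0 ?normrN ?normr1 ?oppr_eq0 ?oner_eq0.
Qed.

Lemma sign0_vec_norm_le1 (R : realType) (n : nat) (y : 'rV[R]_n) i :
  sign0_vec y -> `|y 0 i| <= 1.
Proof.
move=> /(_ i); rewrite !inE => /or3P[] /eqP ->.
- by rewrite normr0.
- by rewrite normr1.
- by rewrite normrN normr1.
Qed.

(** The subtracted term already lives on the common support, and [|y_i| y_i = y_i] for entries in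
    {0, 1, -1}. *)
Lemma pad_mx_sub_sign (R : realType) (n : nat) (y z : 'rV[R]_n)
    (A B : 'M[R]_n) :
  sign0_vec y -> sign0_vec z -> absv y = absv z ->
  pad_mx (absv y) A - diag_mx y *m B *m diag_mx z =
  pad_mx (absv y) (A - diag_mx y *m B *m diag_mx z).
Proof.
move=> hy hz yz; apply/matrixP => i j.
have absM (x : 'rV[R]_n) k : sign0_vec x -> `|x 0 k| * x 0 k = x 0 k.
  move=> /(_ k); rewrite !inE => /or3P[] /eqP ->.
  - by rewrite mulr0.
  - by rewrite mulr1 normr1.
  - by rewrite normrN normr1 mul1r.
have yzj : absv y 0 j = `|z 0 j| by rewrite yz mxE.
rewrite [LHS]mxE !pad_mxE yzj !mul_diag_mx !mul_mx_diag !mxE.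
rewrite -{3}(absM y i hy) -{2}(absM z j hz); ring.
Qed.

Theorem proposition7 (R : realType) (n : nat) (Al Au : 'M[R]_n)
    (hA : lemx Al Au) :
  holds_strongly (@principally_nondegenerate R n) (interval_mx Al Au) <->
  (let Ac := midpoint_mx Al Au in
   let Ad := radius_mx Al Au in
   let e : 'rV[R]_n := const_mx 1 in
   forall y z : 'rV[R]_n, sign0_vec y -> sign0_vec z -> absv y = absv z ->
     0 < \det (diag_mx (e - absv y)
               + diag_mx (absv y) *m Ac *m diag_mx (absv z))
         * \det (diag_mx (e - absv y)
                 + diag_mx (absv y) *m Ac *m diag_mx (absv z)
                 - diag_mx y *m Ad *m diag_mx z)).
Proof.
have hAd i j : 0 <= radius_mx Al Au i j by apply: radius_mx_ge0.
split=> [hP Ac Ad e y z hy hz yz|hdet A hI I _].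
  rewrite -yz -/(pad_mx (absv y) Ac).
  apply: det_segment_gt0 => t /andP[t0 t1].
  rewrite -mulmxA scalemxAr scalemxAl mulmxA pad_mx_sub_sign //.
  rewrite (sign0_absvE hy); apply/eqP => /principal_minor_pad.
  (* Nondegeneracy says nothing about the empty set; there the padded matrix is the identity. *)
  have [->|I0] := eqVneq [set i | y 0 i != 0] set0.
    move=> /principal_minor_pad.
    have -> B : pad_mx (indic_vec R set0) B = 1%:M.
      apply/matrixP => i j; rewrite pad_mxE !mxE !inE.
      by rewrite subr0 !mul0r addr0.
    by rewrite det1 => /eqP; rewrite oner_eq0.
  apply/eqP; apply: hP I0; apply/interval_mx_bound => i j.
  rewrite [X in _ - X]mxE opprD addNKr mxE opprK mul_diag_mx mul_mx_diag !mxE.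
  have := hAd i j; rewrite !mxE => r0.
  rewrite normrM normrM normrM (ger0_norm t0) (ger0_norm r0).
  have yt : `|y 0 i| * t <= 1 by rewrite mulr_ile1 // sign0_vec_norm_le1.
  rewrite mulrA mulrAC ler_piMl // mulr_ile1 ?mulr_ge0 //.
  exact: sign0_vec_norm_le1.
apply/eqP => /principal_minor_pad/det0_col[x x0 Ax].
set Ac := midpoint_mx Al Au in hdet; set Ad := radius_mx Al Au in hAd hdet.
have xE i : i \notin I -> x i 0 = 0.
  by move=> iI; have := pad_mx_mulE I A x i; rewrite (negPf iI) Ax mxE => <-.
have AxE i : i \in I -> \sum_(j in I) A i j * x j 0 = 0.
  by move=> iI; have := pad_mx_mulE I A x i; rewrite iI Ax mxE => <-.
(* Zero entries of [x] inside [I] get sign 1, so that [|z|] is exactly the indicator of [I]. *)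
pose z : 'rV[R]_n := \row_j ((-1) ^+ (x j 0 < 0)%R *+ (j \in I)).
have zE i : i \in I -> z 0 i * x i 0 = `|x i 0|.
  by move=> iI; rewrite mxE iI mulr1n -normrEsign.
pose c i := \sum_(j in I) Ac i j * x j 0.
pose d i := \sum_(j in I) Ad i j * `|x j 0|.
have cd i : i \in I -> `|c i| <= d i.
  (* As [A x] vanishes on [I], [c i] is the [i]-th entry of [(Ac - A) x], and [|Ac - A| <= Ad]. *)
  move=> iI; have -> : c i = c i - \sum_(j in I) A i j * x j 0.
    by rewrite AxE // subr0.
  rewrite -sumrB.
  apply: le_trans (ler_norm_sum _ _ _) _; apply: ler_sum => j _.
  rewrite -mulrBl normrM ler_wpM2r //.
  by move/interval_mx_bound: hI; exact.
(* When [d i = 0], also [c i = 0], and the junk value [c i / 0 = 0] is harmless. *)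
pose t : 'rV[R]_n := \row_i (c i / d i *+ (i \in I)).
have singular : \det (pad_mx (indic_vec R I) Ac
                      - diag_mx t *m (Ad *m diag_mx z)) = 0.
  apply/det0_col; exists x => //; apply/matrixP => i j; rewrite ord1.
  rewrite mulmxBl -!mulmxA mul_diag_mx [LHS]mxE pad_mx_mulE [RHS]mxE !mxE.
  case: ifPn => iI; last by rewrite mulr0n mul0r subr0 xE.
  rewrite mulr1n; have -> : \sum_k Ad i k * (diag_mx z *m x) k 0 = d i.
    rewrite /d [RHS]big_mkcond; apply: eq_bigr => k _.
    rewrite mul_diag_mx mxE; case: ifPn => [/zE -> //|kI].
    by rewrite xE // !mulr0.
  have [d0|d0] := eqVneq (d i) 0; last by rewrite divfK // subrr.
  move: (cd i iI); rewrite d0 normr_le0 => /eqP c0.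
  by rewrite -/(c i) c0 !mul0r subr0.
(* The factor independent of [s] turns having the same sign at all vertices into positivity. *)
pose F s := \det (pad_mx (indic_vec R I) Ac)
  * \det (pad_mx (indic_vec R I) Ac - diag_mx s *m (Ad *m diag_mx z)).
suff : 0 < F t by rewrite /F singular mulr0 ltxx.
(* Only coordinates in [I] move; off [I] they stay 0 as in [t], so each vertex [s] has [|s| = |z|]
   and [hdet] applies to it. *)
apply: (@multiaffine_gt0 _ _ F _ (enum I)) => [s i|i|s sI sE].
- by rewrite /F [in LHS](det_row_affine _ _ _ i) mulrDr !(mulrCA (\det (pad_mx _ _))).
- rewrite mem_enum mxE => iI; rewrite iI mulr1n normrM normfV.
  have [->|d0] := eqVneq (d i) 0; first by rewrite normr0 invr0 mulr0.
  have dge : 0 <= d i by apply: le_trans (cd i iI).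
  by rewrite (ger0_norm dge) ler_pdivrMr ?mul1r ?cd // lt_neqAle eq_sym d0.
have sI' i : i \in I -> s 0 i = 1 \/ s 0 i = - 1.
  by move=> iI; apply: sI; rewrite mem_enum.
have s0 i : i \notin I -> s 0 i = 0.
  by move=> iI; rewrite sE ?mem_enum // mxE (negPf iI).
have absz : absv z = indic_vec R I.
  apply/rowP => i; rewrite !mxE; case: (i \in I); last by rewrite normr0.
  by rewrite mulr1n normr_sign.
have abss : absv s = indic_vec R I.
  apply/rowP => i; rewrite !mxE; have [/sI'[]->|/s0->] := boolP (i \in I).
  - by rewrite normr1.
  - by rewrite normrN normr1.
  - by rewrite normr0.
have hs : sign0_vec s.
  by move=> i; rewrite !inE; have [/sI'[]->|/s0->] := boolP (i \in I);
    rewrite eqxx ?orbT.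
have hz : sign0_vec z.
  move=> i; rewrite !inE mxE; case: (i \in I); last by rewrite eqxx.
  by rewrite mulr1n; case: (_ < _); rewrite ?expr1 ?expr0 eqxx ?orbT.
have := hdet s z hs hz (etrans abss (esym absz)).
by rewrite /F mulmxA absz abss.
Qed.
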